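(* For each $\alpha \in (-\infty,\infty)$ and $\beta \in [-\infty,\infty]$, let $$E(\alpha,\beta) := \left\{ x \in (0,1] : \lim_{n\to\infty} \frac{\log d_n(x)-n}{n^\alpha} = \beta \right\}.$$ Then $\dim_H E(\alpha,\beta) = 1$ in each of the following cases: $\alpha \in (-\infty,1)$ (and $\beta \in [-\infty,\infty]$ arbitrary); $\alpha = 1$ and $\beta \in [-1,\infty]$; $\alpha \in (1,\infty)$ and $\beta \in [0,\infty]$. In all other cases $\dim_H E(\alpha,\beta) = 0$, because $E(\alpha,\beta) = \varnothing$.
   Context: Pierce expansion digits: for $x \in (0,1]$ put $d_1(x) := \lfloor 1/x \rfloor$ and $T(x) := 1 - d_1(x)x$, and for $k \in \mathbb{N}$ put $d_k(x) := d_1(T^{k-1}(x))$ provided $T^{k-1}(x) \neq 0$. All digits $d_k(x)$, $k \in \mathbb{N}$, are defined exactly when $x$ is irrational, and then they form a strictly increasing sequence of positive integers. Convention: a limiting condition on $(d_n(x))_n$, or a condition for all (large) $n$, is only considered for irrational $x$, so rational $x$ do not belong to sets defined by such conditions. $\mathbb{N}=\{1,2,\dots\}$, $\log$ is the natural logarithm, and $\dim_H$ is the Hausdorff dimension (with $\dim_H \varnothing = 0$). *)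

(* Defs.v *)
From mathcomp Require Import all_boot all_order all_algebra.
From mathcomp Require Import all_classical all_reals all_analysis.

Set Implicit Arguments.
Unset Strict Implicit.
Unset Printing Implicit Defensive.

Import Order.TTheory GRing.Theory Num.Theory.
Import numFieldNormedType.Exports.

Local Open Scope classical_set_scope.
Local Open Scope ring_scope.

Definition diam (R : realType) (U : set R) : \bar R :=
  maxe 0%E (ereal_sup [set `|x - y|%:E | x in U & y in U]).

(* The empty set is treated apart because [0 `^ 0 = 1]: it must contribute
   nothing to the 0-dimensional measure, since a finite cover is represented
   by a sequence that is eventually empty. *)
Definition diam_pow (R : realType) (s : R) (U : set R) : \bar R :=
  if U == set0 then 0%E else (diam U `^ s)%E.

Definition delta_cover (R : realType) (delta : R) (A : set R)
    (U : nat -> set R) : Prop :=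
  A `<=` \bigcup_k U k /\ forall k, (diam (U k) <= delta%:E)%E.

Definition hausdorff_premeasure (R : realType) (s delta : R) (A : set R) :
    \bar R :=
  ereal_inf [set (\sum_(0 <= k <oo) diam_pow s (U k))%E
            | U in delta_cover delta A].

(* The premeasures are nonincreasing in [delta], so this supremum is their
   limit as [delta] tends to 0 from the right. *)
Definition hausdorff_measure (R : realType) (s : R) (A : set R) : \bar R :=
  ereal_sup [set hausdorff_premeasure s delta A
            | delta in [set delta : R | 0 < delta]].

Definition hausdorff_dim (R : realType) (A : set R) : \bar R :=
  ereal_inf [set s%:E
            | s in [set s : R | 0 <= s /\ hausdorff_measure s A = 0%E]].

Definition pierce_d1 (R : realType) (x : R) : int := Num.floor (1 / x).

Definition pierce_T (R : realType) (x : R) : R := 1 - (pierce_d1 x)%:~R * x.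

(* The digits are numbered from [k = 1]. Since [1 / 0 = 0], the values are
   meaningless as soon as [iter k.-1 pierce_T x = 0], which never happens for
   irrational [x]. *)
Definition pierce_digit (R : realType) (k : nat) (x : R) : int :=
  pierce_d1 (iter k.-1 (@pierce_T R) x).

(* A limiting condition on the digits is only considered for irrational [x].
   The term of index [n = 0] is irrelevant to the limit. *)
Definition E_set (R : realType) (alpha : R) (beta : \bar R) : set R :=
  [set x : R | [/\ 0 < x <= 1, irrational x &
    ((ln (pierce_digit n x)%:~R - n%:R) / n%:R `^ alpha)%:E @[n --> \oo]
      --> beta]].

(* Main.v *)
Require Import Defs.
From mathcomp Require Import all_boot all_order all_algebra.
From mathcomp Require Import all_classical all_reals all_analysis.

From mathcomp Require Import ring lra zify.

Set Implicit Arguments.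
Unset Strict Implicit.
Unset Printing Implicit Defensive.

Import Order.TTheory GRing.Theory Num.Theory.
Import numFieldNormedType.Exports.

Local Open Scope classical_set_scope.
Local Open Scope ring_scope.

(** Why the theorem holds. A point is determined by its digits through the
    Pierce series, and every increasing sequence of positive integers is the
    digit sequence of an irrational point ([pierce_digit_point],
    [pierce_point_irrational]). Suppose that the n-th digit may take m_n
    values, all smaller than b_n, and that these windows of values are
    disjoint and increasing. Two such points whose digits first differ at rank
    n are at least 1/(b_1 ... b_(n-1) b_n^3) apart ([pierce_point_sep]), while
    prescribing n - 1 digits leaves one choice in m_1 ... m_(n-1). A Cantor
    set of this kind therefore has dimension 1 as soon as ln m_n is equivalent
    to ln b_n and ln b_n is negligible before ln b_1 + ... + ln b_(n-1).

    Both conditions hold when ln d_n is confined to [g n, g n + n^(-K)] for a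
    function g of polynomial growth: the window contains about e^(g n) n^(-K)
    integers, and the logarithm of n^(-K) is negligible before g n
    ([hausdorff_measure_growth]). Since K is arbitrary, g n describes ln d_n
    as precisely as desired, so it suffices to find, for each admissible pair
    (alpha, beta), a function g with (g n - n) / n^alpha tending to beta. The
    functions c n^p + b n^q with c > 0, p > 0 and q < p are enough
    ([dim_E_set_power_growth]).

    The lower bound on the Hausdorff measure does not use a measure on the
    Cantor set. Mixed radix expansions parametrise the set by [0, 1[, and the
    inverse of the parametrisation is s-Hoelder for every s < 1, so a cover of
    the set yields a cover of [0, 1[, to which subadditivity of the Lebesgue
    measure applies ([hausdorff_measure_neq0], [hausdorff_measure_window]).

    In the remaining cases the set is empty because ln d_n >= 0, whence (ln
    d_n - n) / n^alpha >= - n^(1 - alpha), a quantity that tends to -1 if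
    alpha = 1 and to 0 if alpha > 1. *)

(** * Hausdorff measure and dimension on the line *)

Section hausdorff.
Context {R : realType}.
Implicit Types (s : R) (A U : set R).

Lemma diam_ge0 U : (0 <= diam U)%E.
Proof. by rewrite /diam le_max lexx. Qed.

Lemma dist_le_diam U x y : U x -> U y -> (`|x - y|%:E <= diam U)%E.
Proof.
move=> Ux Uy; rewrite /diam le_max; apply/orP; right.
by apply: ereal_sup_ubound; exists x => //; exists y.
Qed.

Lemma diam_le U (r : R) : 0 <= r -> (forall x y, U x -> U y -> `|x - y| <= r) ->
  (diam U <= r%:E)%E.
Proof.
move=> r0 Ur; rewrite /diam ge_max lee_fin r0/=.
apply: ge_ereal_sup => _ [x Ux [y Uy <-]]; rewrite lee_fin; exact: Ur.
Qed.

Lemma diam_set0 : diam (set0 : set R) = 0%E.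
Proof. by apply/eqP; rewrite eq_le diam_ge0 andbT diam_le. Qed.

Lemma diam_pow_ge0 s U : (0 <= diam_pow s U)%E.
Proof. by rewrite /diam_pow; case: ifP => // _; exact: poweR_ge0. Qed.

Lemma hausdorff_premeasure_ge0 s (d : R) A :
  (0 <= hausdorff_premeasure s d A)%E.
Proof.
apply: le_ereal_inf_tmp => _ [U _ <-].
by apply: nneseries_ge0 => k _ _; exact: diam_pow_ge0.
Qed.

(** A mass distribution principle that needs no measure on [A]: if [A] is
    parametrised by [0, 1[ through a map whose inverse is s-Hoelder, a cover
    of [A] by sets [U k] pulls back to a cover of [0, 1[ by sets that lie in
    intervals of length [2 * C * diam (U k) `^ s]. Subadditivity of the Lebesgue
    measure then bounds the sum of the [diam (U k) `^ s] from below. *)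
Lemma hausdorff_measure_neq0 s (C : R) A (g : R -> R) :
  0 <= s -> 0 < C ->
  (forall t, 0 <= t < 1 -> A (g t)) ->
  (forall t u, 0 <= t < 1 -> 0 <= u < 1 -> `|t - u| <= C * `|g t - g u| `^ s) ->
  hausdorff_measure s A <> 0%E.
Proof.
move=> s0 C0 Ag gH H0.
(* The bound is already reached by the premeasure at scale 1, where the
   diameters are finite. *)
suff : (((2 * C)^-1)%:E <= hausdorff_measure s A)%E.
  by rewrite H0 lee_fin leNgt invr_gt0 mulr_gt0.
apply: (@le_trans _ _ (hausdorff_premeasure s 1 A)); last first.
  by apply: ereal_sup_ubound; exists 1 => //=.
apply: le_ereal_inf_tmp => _ [U [AU dU] <-].
(* [V k] is the preimage of [U k]; the interval [W k] contains it, centred at a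
   point [c k] chosen in [V k]. *)
pose V k := [set t : R | 0 <= t < 1 /\ U k (g t)].
pose c k := xget 0 (V k).
pose r k := C * (fine (diam (U k))) `^ s.
pose W k := if U k == set0 then set0 else [set` `[c k - r k, c k + r k]].
have dfin k : (diam (U k))%E = (fine (diam (U k)))%:E.
  rewrite fineK// ge0_fin_numE ?diam_ge0//.
  by apply: le_lt_trans (dU k) _; rewrite ltry.
have r0 k : 0 <= r k by rewrite mulr_ge0 ?powR_ge0// ltW.
have VW k : V k `<=` W k.
  move=> t [t01 Ugt]; rewrite /W; case: ifPn => [/eqP U0|_].
    by rewrite U0 in Ugt.
  have [c01 Ugc] : V k (c k) by rewrite /c; case: xgetP => [x _ //|/(_ t)[]].
  rewrite /= in_itv/= -ler_distl.
  apply: (le_trans (gH _ _ t01 c01)); rewrite ler_pM2l//.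
  apply: ge0_ler_powR => //; rewrite ?nnegrE ?fine_ge0 ?diam_ge0//.
  by rewrite -lee_fin -dfin; exact: dist_le_diam.
have sub : [set` `[0, 1[] `<=` \bigcup_k W k.
  move=> t; rewrite /= in_itv/= => t01.
  have [k _ Uk] := AU _ (Ag _ t01).
  by exists k => //; apply: VW.
have mW k : measurable (W k).
  by rewrite /W; case: ifP => _ //; exact: measurable_itv.
have mI : measurable ([set` `[0, 1[] : set R) by exact: measurable_itv.
have lenI : lebesgue_measure ([set` `[0, 1[] : set R) = 1%E.
  by rewrite lebesgue_measure_itv/= lte_fin ltr01 oppr0 adde0.
have le1 : (1 <= \sum_(0 <= k <oo) lebesgue_measure (W k))%E.
  by rewrite -lenI; exact: measure_sigma_subadditive.
rewrite -(@lee_pmul2l _ (2 * C)%:E) ?fin_numE// ?lte_fin ?mulr_gt0//.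
rewrite -EFinM divff ?gt_eqF ?mulr_gt0//.
rewrite -nneseriesZl; last by move=> k _; exact: diam_pow_ge0.
apply: (le_trans le1); apply: lee_nneseries => k.
  by move=> _ _; exact: measure_ge0.
rewrite /W /diam_pow => _; case: ifP => _; first by rewrite measure0 mule0.
rewrite lebesgue_measure_itv/= dfin -EFinM.
case: ifPn => _; last by rewrite lee_fin !mulr_ge0 ?powR_ge0// ltW.
by rewrite -EFinD lee_fin /r; lra.
Qed.

(** The N intervals of length 1/N that cover the unit interval contribute
    [N * N^-1 `^ s], which is as small as desired when [1 < s]. *)
Lemma hausdorff_measure_gt1_eq0 s A : 1 < s -> (forall x, A x -> 0 < x <= 1) ->
  hausdorff_measure s A = 0%E.
Proof.
move=> s1 A01; apply/eqP; rewrite eq_le; apply/andP; split; last first.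
  apply: (@le_trans _ _ (hausdorff_premeasure s 1 A)).
    exact: hausdorff_premeasure_ge0.
  by apply: ereal_sup_ubound; exists 1 => //=.
apply: ge_ereal_sup => _ [d /= d0 <-].
apply/lee_addgt0Pr => e e0; rewrite add0e.
have s10 : 0 < s - 1 by rewrite subr_gt0.
(* The second bound in the maximum makes [N `^ (1 - s) <= e]. *)
pose N := (Num.trunc (Num.max d^-1 (e^-1 `^ (s - 1)^-1))).+1.
have N0 : 0 < N%:R :> R by rewrite ltr0n.
have : Num.max d^-1 (e^-1 `^ (s - 1)^-1) < N%:R.
  by apply: truncnS_gt; rewrite // le_max invr_ge0 ltW.
rewrite gt_max => /andP[Nd Ne].
have {}Nd : N%:R^-1 <= d by rewrite -[leRHS]invrK lef_pV2 ?posrE ?invr_gt0// ltW.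
have {}Ne : N%:R * N%:R^-1 `^ s <= e.
  have -> : N%:R * N%:R^-1 `^ s = (N%:R `^ (s - 1))^-1.
    rewrite -powR_inv1 ?ler0n// -powRrM mulN1r -powRN opprB.
    by rewrite powRD ?powRr1 ?(gt_eqF N0) ?implybT.
  rewrite -[leRHS]invrK lef_pV2 ?posrE ?invr_gt0 ?powR_gt0//.
  have -> : e^-1 = (e^-1 `^ (s - 1)^-1) `^ (s - 1).
    by rewrite -powRrM mulVf ?gt_eqF// powRr1 ?invr_ge0 ?ltW.
  by apply: ge0_ler_powR; rewrite ?nnegrE ?powR_ge0 ?ler0n// ltW.
pose U k :=
  if (k < N)%N then [set` `](k%:R / N%:R), (k.+1%:R / N%:R)]] else set0 : set R.
have dU k : (diam (U k) <= (N%:R^-1)%:E)%E.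
  apply: diam_le; first by rewrite invr_ge0 ltW.
  move=> x y; rewrite /U; case: ifP => // _; rewrite /= !in_itv/= -natr1 mulrDl mul1r.
  by move=> /andP[? ?] /andP[? ?]; rewrite ler_norml; apply/andP; split; lra.
apply: (@le_trans _ _ (\sum_(0 <= k <oo) diam_pow s (U k))%E).
  apply: ereal_inf_lbound; exists U => //; split; last first.
    by move=> k; apply: le_trans (dU k) _; rewrite lee_fin.
  move=> x /A01 /andP[x0 x1].
  (* The interval that contains [x] ends at [k / N]. *)
  have Nx0 : 0 < x * N%:R by rewrite mulr_gt0.
  pose k := `|Num.ceil (x * N%:R)|%N.
  have kE : k%:R = (Num.ceil (x * N%:R))%:~R :> R.
    by rewrite /k natr_absz ger0_norm// ltW// ceil_gt0.
  have k0 : (0 < k)%N by rewrite -(@ltr_nat R) kE; apply: lt_le_trans Nx0 _; exact: ceil_ge.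
  exists k.-1 => //; rewrite /U ifT; last first.
    rewrite prednK// -(@ler_nat R) kE pmulrn ler_int ceil_le_int.
    by rewrite -pmulrn -[leRHS]mul1r ler_pM2r.
  rewrite /= in_itv/= prednK// ltr_pdivrMr// ler_pdivlMr// kE ceil_ge andbT.
  have : k.-1%:R = k%:R - 1 :> R by rewrite -{2}(prednK k0) -natr1 addrK.
  by move=> ->; rewrite kE; have := ceilB1_lt (x * N%:R); rewrite intrB.
rewrite (@nneseries_split _ _ 0 N); last by move=> *; exact: diam_pow_ge0.
rewrite eseries0 ?adde0; last first.
  by move=> k /= Nk _; rewrite /U ltnNge -[X in (X <= _)%N]add0n Nk/= /diam_pow eqxx.
apply: (@le_trans _ _ (\sum_(0 <= k < N) (N%:R^-1 `^ s)%:E)%E).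
  apply: lee_sum => k _; rewrite /diam_pow; case: ifP => _.
    by rewrite lee_fin powR_ge0.
  rewrite -poweR_EFin; apply: gt0_ler_poweR;
    rewrite ?in_itv/= ?diam_ge0 ?leey ?(ltW (lt_trans _ s1))//.
  by rewrite lee_fin invr_ge0 ltW.
by rewrite sumEFin lee_fin sumr_const_nat subn0 -[leLHS]mulr_natl.
Qed.

Lemma hausdorff_dim_set0 : hausdorff_dim (set0 : set R) = 0%E.
Proof.
apply/eqP; rewrite eq_le; apply/andP; split; last first.
  by apply: le_ereal_inf_tmp => _ [s [s0 _] <-]; rewrite lee_fin.
apply: ereal_inf_lbound; exists 0 => //; split => //.
apply/eqP; rewrite eq_le; apply/andP; split; last first.
  apply: (@le_trans _ _ (hausdorff_premeasure 0 1 set0)).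
    exact: hausdorff_premeasure_ge0.
  by apply: ereal_sup_ubound; exists 1 => //=.
apply: ge_ereal_sup => _ [d /= d0 <-].
apply: ereal_inf_lbound; exists (fun=> set0).
  by split => // k; rewrite diam_set0 lee_fin ltW.
by apply: eseries0 => k _ _; rewrite /diam_pow eqxx.
Qed.

Lemma hausdorff_dim1 A : (forall x, A x -> 0 < x <= 1) ->
  (forall s, 0 <= s -> s < 1 -> hausdorff_measure s A <> 0%E) ->
  hausdorff_dim A = 1%E.
Proof.
move=> A01 AN0; apply/eqP; rewrite eq_le; apply/andP; split.
  apply/lee_addgt0Pr => e e0; apply: ereal_inf_lbound.
  exists (1 + e) => //; split; first by rewrite addr_ge0// ltW.
  by apply: hausdorff_measure_gt1_eq0 => //; rewrite ltrDl.
apply: le_ereal_inf_tmp => _ [s [s0 H0] <-]; rewrite lee_fin leNgt.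
by apply/negP => s1; exact: (AN0 _ s0 s1).
Qed.

End hausdorff.

(** * Points with prescribed Pierce digits *)

Definition digit_seq (d : nat -> nat) :=
  (0 < d 0)%N /\ forall k, (d k < d k.+1)%N.

Definition shift (d : nat -> nat) k := d k.+1.

Lemma digit_seq_gt d k : digit_seq d -> (k < d k)%N.
Proof.
move=> [d0 dS]; elim: k => [//|k IH]; exact: leq_ltn_trans IH (dS k).
Qed.

Lemma digit_seq_shift d : digit_seq d -> digit_seq (shift d).
Proof.
by move=> [d0 dS]; split=> [|k]; [exact: leq_trans (dS 0)|exact: dS].
Qed.

Section pierce_point.
Context {R : realType}.
Implicit Types d e : nat -> nat.

(** The Pierce series 1/d_0 - 1/(d_0 d_1) + 1/(d_0 d_1 d_2) - ... *)
Definition pierce_term d (k : nat) : R := (-1) ^+ k / \prod_(i < k.+1) (d i)%:R.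

Definition pierce_point d : R := limn (series (pierce_term d)).

(** Since [k < d k], the series is dominated by that of the exponential. *)
Lemma is_cvg_pierce d : digit_seq d -> cvgn (series (pierce_term d)).
Proof.
move=> dd; apply: normed_cvg.
apply: (@series_le_cvg _ _ (exp_coeff 1)).
- by move=> k /=.
- by move=> k; apply: exp_coeff_ge0.
- move=> k; rewrite /= /pierce_term normrM normrX normrN1 expr1n mul1r normfV.
  rewrite /exp_coeff /= expr1n mul1r ger0_norm ?prodr_ge0// lef_pV2 ?posrE; last 2 first.
  + by apply: prodr_gt0 => i _; rewrite ltr0n (leq_trans _ (digit_seq_gt i dd)).
  + by rewrite ltr0n fact_gt0.
  rewrite -natr_prod ler_nat; elim: k => [|k IH].
    by rewrite big_ord_recr big_ord0/= mul1n; case: dd.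
  rewrite big_ord_recr/= factS mulnC leq_mul//.
  exact: ltnW (digit_seq_gt k.+1 dd).
- exact: is_cvg_series_exp_coeff.
Qed.

Lemma series_pierceS d n :
  series (pierce_term d) n.+1 = (1 - series (pierce_term (shift d)) n) / (d 0%N)%:R.
Proof.
rewrite /series /= big_nat_recl// mulrBl mul1r; congr (_ + _).
  by rewrite /pierce_term expr0 big_ord_recr big_ord0/= !mul1r.
rewrite big_distrl/= -sumrN; apply: eq_bigr => k _.
rewrite /pierce_term [in X in _ / X]big_ord_recl /= exprS invfM.
by rewrite mulN1r !mulNr mulrA mulrAC.
Qed.

Lemma series_pierce_itv d n : digit_seq d -> 0 <= series (pierce_term d) n <= 1.
Proof.
elim: n d => [|n IH] d dd; first by rewrite /series/= big_geq// lexx ler01.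
have /andP[s0 s1] := IH _ (digit_seq_shift dd).
have d1 : 1 <= (d 0%N)%:R :> R by rewrite ler1n; case: dd.
rewrite series_pierceS divr_ge0 ?subr_ge0 ?ler0n//= ler_pdivrMr ?(lt_le_trans _ d1)//.
lra.
Qed.

Lemma pierce_pointS d : digit_seq d ->
  pierce_point d = (1 - pierce_point (shift d)) / (d 0%N)%:R.
Proof.
move=> dd; apply: cvg_lim => //.
rewrite -cvg_shiftS /=; under eq_fun do rewrite series_pierceS.
apply: cvgMr_tmp; apply: cvgB; first exact: cvg_cst.
exact: is_cvg_pierce (digit_seq_shift dd).
Qed.

Lemma pierce_point_itv01 d : digit_seq d -> 0 <= pierce_point d <= 1.
Proof.
move=> dd; have cd := is_cvg_pierce dd; apply/andP; split.
  by apply: limr_ge => //; apply: nearW => n; have /andP[] := series_pierce_itv n dd.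
by apply: limr_le => //; apply: nearW => n; have /andP[] := series_pierce_itv n dd.
Qed.

(** Each bound for [d] follows from [pierce_pointS] and a weaker bound for
    [shift d]: from [0 <= x <= 1] to [x <= (d 0)^-1], then to [0 < x], then to
    [x < (d 0)^-1], and at last to the lower bound, because [d 0 < d 1]. *)
Lemma pierce_point_itv d : digit_seq d ->
  (d 0%N).+1%:R^-1 < pierce_point d < (d 0%N)%:R^-1.
Proof.
have ub e : digit_seq e -> pierce_point e <= (e 0%N)%:R^-1.
  move=> ee; rewrite pierce_pointS// ler_pdivrMr; last by rewrite ltr0n; case: ee.
  rewrite mulVf ?pnatr_eq0 -?lt0n//; last by case: ee.
  by have /andP[] := pierce_point_itv01 (digit_seq_shift ee); lra.
have gt0 e : digit_seq e -> 0 < pierce_point e.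
  move=> ee; rewrite pierce_pointS// divr_gt0 ?ltr0n//; last by case: ee.
  rewrite subr_gt0 (le_lt_trans (ub _ (digit_seq_shift ee)))//.
  rewrite invf_lt1 ?ltr0n ?ltr1n /shift; last by rewrite (leq_trans _ (digit_seq_gt 1 ee)).
  exact: digit_seq_gt ee.
have ub' e : digit_seq e -> pierce_point e < (e 0%N)%:R^-1.
  move=> ee; rewrite pierce_pointS// ltr_pdivrMr; last by rewrite ltr0n; case: ee.
  rewrite mulVf ?pnatr_eq0 -?lt0n//; last by case: ee.
  by have := gt0 _ (digit_seq_shift ee); lra.
move=> dd; rewrite ub'// andbT pierce_pointS//.
have d0 : 0 < (d 0%N)%:R :> R by rewrite ltr0n; case: dd.
rewrite ltr_pdivlMr// ltrBrDr -ltrBrDl.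
apply: (lt_le_trans (ub' _ (digit_seq_shift dd))).
apply: (@le_trans _ _ (d 0%N).+1%:R^-1).
  rewrite lef_pV2 ?posrE ?ltr0n//; last by case: (digit_seq_shift dd).
  by rewrite ler_nat; case: dd.
rewrite -natr1 le_eqVlt; apply/orP; left; apply/eqP; field; lra.
Qed.

Lemma pierce_d1_point d : digit_seq d -> pierce_d1 (pierce_point d) = (d 0%N)%:Z.
Proof.
move=> dd; have /andP[lb ub] := pierce_point_itv dd.
have d0 : 0 < (d 0%N)%:R :> R by rewrite ltr0n; case: dd.
have x0 : 0 < pierce_point d by apply: lt_trans lb; rewrite invr_gt0 ltr0n.
apply: floor_def; rewrite div1r -[_ + 1]/(((d 0)%N + 1)%N%:Z) addn1.
rewrite -!pmulrn -[leLHS]invrK lef_pV2 ?posrE ?invr_gt0//.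
by rewrite -[ltRHS]invrK ltf_pV2 ?posrE ?invr_gt0 ?ltr0n// lb ltW.
Qed.

Lemma pierce_T_point d : digit_seq d ->
  pierce_T (pierce_point d) = pierce_point (shift d).
Proof.
move=> dd; rewrite /pierce_T pierce_d1_point// pierce_pointS// -pmulrn mulrC divfK.
  by rewrite opprB addrC subrK.
by rewrite pnatr_eq0 -lt0n; case: dd.
Qed.

Lemma pierce_digit_point d n : digit_seq d ->
  pierce_digit n.+1 (pierce_point d) = (d n)%:Z.
Proof.
rewrite /pierce_digit /=; elim: n d => [|n IH] d dd; first exact: pierce_d1_point.
by rewrite iterSr pierce_T_point// IH//; exact: digit_seq_shift.
Qed.

(** On a fraction p/q, [pierce_T] keeps the denominator and replaces the
    numerator by [q - d 0 * p], which is smaller than [p]: an infinite expansion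
    would give an infinite descent. *)
Lemma pierce_point_neq d (p q : nat) : digit_seq d -> pierce_point d <> p%:R / q%:R.
Proof.
elim/ltn_ind: p d => p IH d dd dpq.
have /andP[lb ub] := pierce_point_itv dd.
have d0 : 0 < (d 0%N)%:R :> R by rewrite ltr0n; case: dd.
have x0 : 0 < pierce_point d by apply: lt_trans lb; rewrite invr_gt0 ltr0n.
have q0 : (0 < q)%N.
  by case: q dpq {IH} => // dpq; rewrite dpq invr0 mulr0 ltxx in x0.
have q0' : 0 < q%:R :> R by rewrite ltr0n.
have pq : p%:R = pierce_point d * q%:R by rewrite dpq divfK ?gt_eqF.
have dpq' : (d 0%N * p < q)%N.
  rewrite -(@ltr_nat R) natrM pq -[ltRHS]mul1r mulrA ltr_pM2r//.
  by rewrite mulrC -ltr_pdivlMr// div1r.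
have qp : (q < (d 0%N).+1 * p)%N.
  rewrite -(@ltr_nat R) natrM pq -[ltLHS]mul1r mulrA ltr_pM2r//.
  by rewrite mulrC -ltr_pdivrMr ?ltr0n// div1r.
apply: (IH (q - d 0 * p)%N _ (shift d)); [|exact: digit_seq_shift|].
  by rewrite ltn_subLR ?(ltnW dpq')// -mulSnr.
rewrite -pierce_T_point// /pierce_T pierce_d1_point// -pmulrn natrB ?(ltnW dpq')//.
by rewrite mulrBl divff ?gt_eqF// dpq natrM mulrA.
Qed.

Lemma pierce_point_irrational d : digit_seq d -> irrational (pierce_point d).
Proof.
move=> dd; rewrite /irrational /= => /rationalP[a [b ab]].
have /andP[x0 _] := pierce_point_itv01 dd.
apply: (@pierce_point_neq d `|a|%N b dd); rewrite ab.
case: (leP 0 a) => a0; first by rewrite natr_absz ger0_norm.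
have : pierce_point d <= 0.
  by rewrite ab pmulrn mulr_le0_ge0 ?invr_ge0 ?ler0n// lerz0 ltW.
have /andP[lb _] := pierce_point_itv dd.
by rewrite leNgt (lt_trans _ lb)// invr_gt0 ltr0n.
Qed.

(** Two points with adjacent first digits could be arbitrarily close if the
    second digit of the larger one were unrestricted. Here [e 0 < d 1] keeps
    the larger one away from the common endpoint of the two cylinders; with
    [b = e 0], their distance is more than 1/(b (b^2 - 1)). *)
Lemma pierce_point_sep_head d e : digit_seq d -> digit_seq e ->
  (d 0 < e 0)%N -> (e 0 < d 1)%N ->
  (e 0%N)%:R ^- 3 <= pierce_point d - pierce_point e.
Proof.
move=> dd ee de ed.
have d0 : 1 <= (d 0%N)%:R :> R by rewrite ler1n; case: dd.
have dE : (d 0%N)%:R + 1 <= (e 0%N)%:R :> R by rewrite natr1 ler_nat.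
have /andP[_ ub] := pierce_point_itv ee.
have /andP[_ ub'] := pierce_point_itv (digit_seq_shift dd).
have {ub'} ub' : pierce_point (shift d) <= ((e 0%N)%:R + 1)^-1.
  apply: (le_trans (ltW ub')); rewrite natr1 lef_pV2 ?posrE ?ltr0n ?ler_nat//.
  exact: leq_trans ed.
rewrite pierce_pointS//; set x := pierce_point e in ub *.
set y := pierce_point _ in ub' *; set a := (d 0%N)%:R in d0 dE *.
set b := (e 0%N)%:R in dE ub ub' *.
have b1 : 2 <= b by lra.
(* The worst case is [a = b - 1], with [y] and [x] at their upper bounds. *)
apply: (@le_trans _ _ ((1 - (b + 1)^-1) / (b - 1) - b^-1)); last first.
  apply: lerB; last exact: ltW.
  have bp : 0 <= 1 - (b + 1)^-1 by rewrite subr_ge0 invf_le1; lra.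
  apply: (@le_trans _ _ ((1 - (b + 1)^-1) / a)).
    by rewrite ler_wpM2l// lef_pV2 ?posrE; lra.
  by rewrite ler_wpM2r ?invr_ge0; lra.
have -> : (1 - (b + 1)^-1) / (b - 1) - b^-1 = (b * (b ^+ 2 - 1))^-1.
  by field; rewrite -/b; apply/and4P; split; apply: lt0r_neq0; nra.
rewrite lef_pV2 ?posrE; nra.
Qed.

(** A common first digit contracts distances by exactly that digit. *)
Lemma pierce_point_sep n d e : digit_seq d -> digit_seq e ->
  (forall k, (k < n)%N -> d k = e k) -> (d n < e n)%N -> (e n < d n.+1)%N ->
  ((\prod_(k < n) (d k)%:R) * (e n)%:R ^+ 3)^-1 <= `|pierce_point d - pierce_point e|.
Proof.
elim: n d e => [|n IH] d e dd ee de den edn.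
  rewrite big_ord0 mul1r (le_trans _ (ler_norm _))//.
  exact: pierce_point_sep_head.
have d0 : 0 < (d 0%N)%:R :> R by rewrite ltr0n; case: dd.
rewrite (pierce_pointS dd) (pierce_pointS ee) -(de 0%N)// -mulrBl normrM.
rewrite opprB [_ + (_ - _)]addrC subrKA distrC [`|_^-1|]gtr0_norm ?invr_gt0//.
rewrite ler_pdivlMr// big_ord_recl /= -mulrA invfM mulrC mulrA divff ?gt_eqF// mul1r.
apply: IH => //; try exact: digit_seq_shift.
by move=> k kn; exact: de.
Qed.

End pierce_point.

(** * Mixed radix expansions *)

Section radix.
Context {R : realType}.
Context (m : nat -> nat) (m_gt0 : forall k, (0 < m k)%N).
Implicit Types t u : R.

(** [radix_rem t n] is what remains of [t] after [n] digits of its expansion in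
    the mixed radix [m], rescaled to [0, 1[. *)
Fixpoint radix_rem t n : R :=
  if n is k.+1 then (m k)%:R * radix_rem t k - (Num.trunc ((m k)%:R * radix_rem t k))%:R
  else t.

Definition radix_digit t n : nat := Num.trunc ((m n)%:R * radix_rem t n).

Lemma radix_rem_itv t n : 0 <= t < 1 -> 0 <= radix_rem t n < 1.
Proof.
move=> t01; elim: n => [//|n /andP[r0 r1]] /=.
have := @truncn_itv R ((m n)%:R * radix_rem t n).
rewrite mulr_ge0 ?ler0n// => /(_ isT) /andP[l u].
by rewrite subr_ge0 l/= ltrBlDl natr1.
Qed.

Lemma radix_digit_lt t n : 0 <= t < 1 -> (radix_digit t n < m n)%N.
Proof.
move=> t01; have /andP[r0 r1] := radix_rem_itv n t01.
have m0 : 0 < (m n)%:R :> R by rewrite ltr0n.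
rewrite /radix_digit truncn_lt_nat ?mulr_ge0 ?ler0n//.
by rewrite -[ltRHS]mulr1 ltr_pM2l.
Qed.

Lemma radix_remB t u n :
  (forall k, (k < n)%N -> radix_digit t k = radix_digit u k) ->
  radix_rem t n - radix_rem u n = (\prod_(k < n) (m k)%:R) * (t - u).
Proof.
elim: n => [|n IH] tu; first by rewrite big_ord0 mul1r.
rewrite big_ord_recr/= mulrAC -IH; last by move=> k kn; exact: tu (ltnW kn).
rewrite -/(radix_digit t n) -/(radix_digit u n) tu//; ring.
Qed.

Lemma radix_dist t u n : 0 <= t < 1 -> 0 <= u < 1 ->
  (forall k, (k < n)%N -> radix_digit t k = radix_digit u k) ->
  `|t - u| <= (\prod_(k < n) (m k)%:R)^-1.
Proof.
move=> t01 u01 /radix_remB tu.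
have P0 : 0 < \prod_(k < n) (m k)%:R :> R by apply: prodr_gt0 => k _; rewrite ltr0n.
rewrite -[leRHS]mul1r ler_pdivlMr// mulrC -{1}(gtr0_norm P0) -normrM -tu.
have := radix_rem_itv n t01; have := radix_rem_itv n u01.
by move=> /andP[? ?] /andP[? ?]; rewrite ler_norml; apply/andP; split; lra.
Qed.

End radix.

(** * Cantor sets of digits in disjoint windows *)

Section windows.
Context {R : realType}.
Context (a m : nat -> nat) (a0_gt0 : (0 < a 0)%N).
Context (m_gt0 : forall k, (0 < m k)%N).
Context (aS : forall k, (a k + m k <= a k.+1)%N).

Let b k : R := (a k + m k)%:R.

Definition window_seq (t : R) k : nat := (a k + radix_digit m t k)%N.

Lemma window_seq_itv t k : 0 <= t < 1 -> (a k <= window_seq t k < a k + m k)%N.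
Proof.
by move=> t01; rewrite leq_addr ltn_add2l radix_digit_lt.
Qed.

Lemma digit_seq_window t : 0 <= t < 1 -> digit_seq (window_seq t).
Proof.
move=> t01; split=> [|k]; first exact: leq_trans (leq_addr _ _).
have /andP[_ h] := window_seq_itv k t01.
by have /andP[l _] := window_seq_itv k.+1 t01; rewrite (leq_trans h)// (leq_trans (aS k)).
Qed.

(** The parametrisation sends [t] to the Pierce point whose k-th digit is
    [a k] plus the k-th mixed radix digit of [t]. When two parameters first
    differ at digit [n], they are within [(\prod_(k < n) m k)^-1] of each other,
    while their images are at least [(\prod_(k < n) b k * b n ^+ 3)^-1] apart;
    the second hypothesis compares the two, which is the Hoelder bound of
    [hausdorff_measure_neq0]. *)
Lemma hausdorff_measure_window (A : set R) :
  (forall d, digit_seq d -> (forall k, (a k <= d k < a k + m k)%N) ->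
    A (pierce_point d)) ->
  (forall s : R, 0 <= s < 1 -> exists2 C : R, 0 < C & forall n,
     (\prod_(k < n) b k * b n ^+ 3) `^ s <= C * \prod_(k < n) (m k)%:R) ->
  forall s : R, 0 <= s -> s < 1 -> hausdorff_measure s A <> 0%E.
Proof.
move=> Aw Hs s s0 s1; have [|C C0 HC] := Hs s; first by rewrite s0.
have b1 k : k.+1%:R <= b k.
  rewrite /b ler_nat; elim: k => [|k IH]; first exact: leq_trans (leq_addr _ _).
  apply: (leq_ltn_trans IH); rewrite -addn1 leq_add//.
have b0 k : 0 < b k by apply: lt_le_trans (b1 k); rewrite ltr0n.
have M0 n : 0 < \prod_(k < n) (m k)%:R :> R by apply: prodr_gt0 => k _; rewrite ltr0n.
have B1 n : 1 <= \prod_(k < n) b k.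
  elim: n => [|n IH]; first by rewrite big_ord0.
  by rewrite big_ord_recr/= mulr_ege1// (le_trans _ (b1 n))// ler1n.
have B0 n : 0 < \prod_(k < n) b k by apply: lt_le_trans (B1 n).
(* The exponent 1/2 of the hypothesis makes the products of the [m k] unbounded,
   so a parameter is determined by its digits. *)
have agree (t u : R) : 0 <= t < 1 -> 0 <= u < 1 ->
    (forall k, radix_digit m t k = radix_digit m u k) -> t = u.
  move=> t01 u01 tu; apply/eqP; rewrite -subr_eq0 -normr_le0 leNgt; apply/negP => d0.
  have [|D D0 HD] := Hs 2^-1; first by lra.
  pose n := Num.trunc (D / `|t - u|).
  have : D / `|t - u| < n.+1%:R by apply: truncnS_gt.
  rewrite ltr_pdivrMr// => Dn.
  have tun : `|t - u| <= (\prod_(k < n) (m k)%:R)^-1 by apply: radix_dist.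
  have nM : n.+1%:R <= D * \prod_(k < n) (m k)%:R.
    apply: le_trans (HD n).
    have n1 : 1 <= n.+1%:R :> R by rewrite ler1n.
    apply: (@le_trans _ _ ((n.+1%:R ^+ 2) `^ 2^-1)).
      by rewrite powR12_sqrt ?sqr_ge0// sqrtr_sqr gtr0_norm.
    apply: ge0_ler_powR;
      rewrite ?nnegrE ?invr_ge0 ?mulr_ge0 ?exprn_ge0 ?(ltW (b0 _)) ?(ltW (B0 _))//.
    rewrite -[leLHS]mul1r; apply: ler_pM; rewrite ?exprn_ge0//.
    apply: (@le_trans _ _ (n.+1%:R ^+ 3)); first by rewrite ler_weXn2l.
    by rewrite lerXn2r ?nnegrE// ltW.
  have : D < D.
    apply: (lt_le_trans Dn); apply: (le_trans (ler_wpM2r (ltW d0) nM)).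
    rewrite -mulrA ger_pMr// mulrC -ler_pdivlMr// div1r//.
  by rewrite ltxx.
apply: (@hausdorff_measure_neq0 _ _ C A (fun t => pierce_point (window_seq t))) => //.
  move=> t t01; apply: Aw; first exact: digit_seq_window.
  by move=> k; exact: window_seq_itv.
have key n (t u : R) : 0 <= t < 1 -> 0 <= u < 1 ->
    (forall k, (k < n)%N -> radix_digit m t k = radix_digit m u k) ->
    (radix_digit m t n < radix_digit m u n)%N ->
    `|t - u| <= C * `|pierce_point (window_seq t) - pierce_point (window_seq u)| `^ s.
  move=> t01 u01 tu ltn.
  apply: (le_trans (radix_dist m_gt0 t01 u01 tu)).
  have le2 : ((\prod_(k < n) b k * b n ^+ 3)^-1) `^ s <=
     `|pierce_point (window_seq t) - pierce_point (window_seq u)| `^ s.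
    apply: ge0_ler_powR;
      rewrite ?nnegrE ?invr_ge0 ?mulr_ge0 ?exprn_ge0 ?(ltW (b0 _)) ?(ltW (B0 _))//.
    have [dt du] := (digit_seq_window t01, digit_seq_window u01).
    apply: le_trans (@pierce_point_sep _ n _ _ dt du _ _ _).
    + have tb v k : 0 <= v < 1 -> (window_seq v k < a k + m k)%N.
        by move=> v01; have /andP[] := window_seq_itv k v01.
      have dp v k : 0 <= v < 1 -> 0 < (window_seq v k)%:R :> R.
        move=> v01; rewrite ltr0n.
        by rewrite (leq_trans _ (digit_seq_gt k (digit_seq_window v01))).
      have tub v k : 0 <= v < 1 -> (window_seq v k)%:R <= b k.
        by move=> v01; rewrite ler_nat ltnW// tb.
      have Pt : 0 < \prod_(k < n) (window_seq t k)%:R :> R.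
        by apply: prodr_gt0 => k _; exact: dp.
      have Pu : 0 < (window_seq u n)%:R ^+ 3 :> R by rewrite exprn_gt0// dp.
      rewrite lef_pV2 ?posrE ?(mulr_gt0 Pt Pu) ?mulr_gt0 ?exprn_gt0//.
      apply: ler_pM; [exact: ltW|exact: ltW| |].
      * by apply: ler_prod => k _; rewrite ler0n tub.
      * by rewrite lerXn2r ?nnegrE ?tub// ltW.
    + by move=> k kn; rewrite /window_seq tu.
    + by rewrite /window_seq ltn_add2l.
    + have /andP[_ h] := window_seq_itv n u01.
      have /andP[l _] := window_seq_itv n.+1 t01.
      by rewrite (leq_trans h)// (leq_trans (aS n)).
  apply: le_trans (ler_wpM2l (ltW C0) le2).
  have P0 : 0 < \prod_(k < n) b k * b n ^+ 3 by rewrite mulr_gt0 ?exprn_gt0.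
  rewrite -[X in powR X s]powR_inv1 ?(ltW P0)// -powRrM mulN1r powRN.
  by rewrite ler_pdivlMr ?powR_gt0// ler_pdivrMl// [leRHS]mulrC.
move=> t u t01 u01.
have [tu|/existsNP tu] := pselect (forall k, radix_digit m t k = radix_digit m u k).
  by rewrite (agree _ _ t01 u01 tu) subrr normr0 mulr_ge0 ?powR_ge0// ltW.
have tu' : exists k, radix_digit m t k != radix_digit m u k.
  by have [k /eqP tuk] := tu; exists k.
case: (ex_minnP tu') => n ntu nmin.
have agr k : (k < n)%N -> radix_digit m t k = radix_digit m u k.
  by move=> kn; apply/eqP/negPn/negP => /nmin; rewrite leqNgt kn.
move: ntu; rewrite neq_ltn => /orP[ltn|ltn]; first exact: (key n).
rewrite distrC [X in powR X _]distrC; apply: (key n) => // k kn.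
by rewrite agr.
Qed.

End windows.

(** * Number of choices against size of the digits *)

Lemma near_succ (P : nat -> Prop) :
  (\forall n \near \oo, P n) -> \forall n \near \oo, P n.+1.
Proof. by case=> N _ NP; exists N => // n /= Nn; apply: NP => /=; exact: leqW. Qed.

Section growth.
Context {R : realType}.

Lemma near_ler_sum (f g : nat -> R) : (\forall k \near \oo, f k <= g k) ->
  exists c, forall n, \sum_(k < n) f k <= \sum_(k < n) g k + c.
Proof.
case=> N _ fg; exists (\sum_(k < N) `|f k - g k|) => n.
rewrite -lerBlDl -sumrB.
have [nN|Nn] := leqP n N.
  rewrite (big_ord_widen_cond N xpredT (fun k => f k - g k))// big_mkcond/=.
  by apply: ler_sum => k _; case: ifP => _; rewrite ?normr_ge0// ler_norm.
rewrite -(big_mkord xpredT (fun k => f k - g k)) (big_cat_nat (n := N))//=; last exact: ltnW.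
rewrite -[leRHS]addr0 lerD//.
  by rewrite big_mkord; apply: ler_sum => k _; exact: ler_norm.
rewrite big_nat_cond; apply: sumr_le0 => k /andP[/andP[Nk _] _].
by rewrite subr_le0; exact: fg.
Qed.

Lemma near_ler (f g : nat -> R) : (\forall k \near \oo, f k <= g k) ->
  exists c, forall n, f n <= g n + c.
Proof.
case=> N _ fg; exists (\sum_(k < N) `|f k - g k|) => n.
have [nN|Nn] := ltnP n N; last first.
  by apply: (le_trans (fg n Nn)); rewrite lerDl sumr_ge0.
rewrite -lerBlDl (bigD1 (Ordinal nN))//= (le_trans (ler_norm _))// lerDl.
by rewrite sumr_ge0.
Qed.

Lemma ln_prod (f : nat -> R) n : (forall k, 0 < f k) ->
  ln (\prod_(k < n) f k) = \sum_(k < n) ln (f k).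
Proof.
move=> f0; elim: n => [|n IH]; first by rewrite !big_ord0 ln1.
by rewrite !big_ord_recr/= lnM ?posrE ?IH ?prodr_gt0.
Qed.

(** Taking logarithms, the claim is that [s * (L + 3 * ln (b n))] is at most
    [\sum_(k < n) ln (m k)] up to a constant, where [L] is the sum of the
    [ln (b k)] for [k < n]. The first asymptotic hypothesis bounds the
    right-hand side below by [(1 - eps) * L], and the second one makes [ln (b n)]
    negligible before [L], so any [s < 1] leaves enough room. *)
Lemma window_exponent (b m : nat -> R) :
  (forall k, 1 <= b k) -> (forall k, 0 < m k) ->
  (forall eps, 0 < eps -> \forall k \near \oo, (1 - eps) * ln (b k) <= ln (m k)) ->
  (forall eps, 0 < eps -> \forall n \near \oo,
     ln (b n) <= eps * \sum_(k < n) ln (b k)) ->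
  forall s, 0 <= s < 1 -> exists2 C, 0 < C & forall n,
    (\prod_(k < n) b k * b n ^+ 3) `^ s <= C * \prod_(k < n) m k.
Proof.
move=> b1 m0 H1 H2 s /andP[s0 s1].
have b0 k : 0 < b k by apply: lt_le_trans (b1 k).
(* With this [eps], [s + 3 * s * eps <= 1 - eps]. *)
pose eps := (1 - s) / 4; have e0 : 0 < eps by rewrite /eps; lra.
have [c1 Hc1] := near_ler_sum (H1 _ e0).
have [c2 Hc2] := near_ler (H2 _ e0).
exists (expR (c1 + 3 * s * c2)); first exact: expR_gt0.
move=> n.
have B0 : 0 < \prod_(k < n) b k by apply: prodr_gt0.
have M0 : 0 < \prod_(k < n) m k by apply: prodr_gt0.
rewrite /powR gt_eqF ?mulr_gt0 ?exprn_gt0//.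
rewrite -[X in _ <= _ * X]lnK ?posrE// -expRD ler_expR.
rewrite lnM ?posrE ?exprn_gt0// lnXn// !ln_prod//.
have := Hc1 n; have := Hc2 n; rewrite -mulr_sumr.
have : 0 <= \sum_(k < n) ln (b k) by apply: sumr_ge0 => k _; exact: ln_ge0.
set SL := \sum_(k < n) ln (b k); set SM := \sum_(k < n) ln (m k).
move=> SL0 h2 h1; rewrite -mulr_natl.
have h3 : s * (3 * ln (b n)) <= s * (3 * (eps * SL + c2)).
  by apply: ler_wpM2l => //; lra.
have h4 : 0 <= eps * (1 - s) * SL by rewrite !mulr_ge0//; lra.
have es : s = 1 - 4 * eps by rewrite /eps; lra.
rewrite mulrDr; nra.
Qed.


Lemma near_powR_ge (r M : R) : 0 < r -> \forall n \near \oo, M <= n%:R `^ r.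
Proof.
move=> r0; near=> n.
have [M0|M0] := leP M 0; first by rewrite (le_trans M0)// powR_ge0.
have -> : M = (M `^ r^-1) `^ r by rewrite -powRrM mulVf ?gt_eqF// powRr1 ?ltW.
apply: ge0_ler_powR; rewrite ?nnegrE ?powR_ge0 ?ler0n ?(ltW r0)//.
by near: n; exact: nbhs_infty_ger.
Unshelve. all: end_near. Qed.

(** From [ln y < y] at [y = n `^ (p / 2)]: the logarithm is at most a constant
    times [y], and [y] is negligible before [y * y = n `^ p]. *)
Lemma near_ln_le_powR (p M : R) : 0 < p ->
  \forall n \near \oo, M * (1 + ln n%:R) <= n%:R `^ p.
Proof.
move=> p0; near=> n.
have n1 : 1 <= n%:R :> R by near: n; exact: nbhs_infty_ger.
have n0 : 0 < n%:R :> R by lra.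
have l0 : 0 <= ln n%:R :> R by exact: ln_ge0.
have [M0|M0] := leP M 0.
  by rewrite (le_trans _ (powR_ge0 _ _))// mulr_le0_ge0//; lra.
pose y : R := n%:R `^ (p / 2).
have yE : n%:R `^ p = y * y by rewrite /y -powRD ?gt_eqF ?implybT// -splitr.
have y1 : M * (1 + 2 / p) <= y by rewrite /y; near: n; apply: near_powR_ge; lra.
have y0 : 0 < y by rewrite powR_gt0.
have : ln y < y by exact: ln_sublinear.
rewrite /y ln_powR -/y => ly.
have {}ly : ln n%:R <= 2 / p * y.
  have := ler_wpM2l (ltW (divr_gt0 (ltr0n R 2) p0)) (ltW ly).
  by rewrite mulrA (_ : 2 / p * (p / 2) = 1) ?mul1r//; field; lra.
have yy : 1 <= y.
  by rewrite -(powRr0 n%:R) /y ler_powR//; lra.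
rewrite yE; apply: (@le_trans _ _ (M * (1 + 2 / p) * y)); last by rewrite ler_pM2r.
rewrite -mulrA ler_pM2l// mulrDl mul1r lerD//.
Unshelve. all: end_near. Qed.

(** The upper half of the indices below [n] already contributes about [n / 2]
    terms of the same order of magnitude as [l n]. *)
Lemma poly_growth_sum (l : nat -> R) (c1 c2 p : R) :
  0 < c1 -> 0 < c2 -> 0 < p -> (forall k, 0 <= l k) ->
  (\forall k \near \oo, c1 * k.+1%:R `^ p <= l k <= c2 * k.+1%:R `^ p) ->
  forall eps, 0 < eps -> \forall n \near \oo, l n <= eps * \sum_(k < n) l k.
Proof.
move=> c10 c20 p0 l0 [N _ HN] eps e0; near=> n.
have nN : (N.*2 <= n)%N by near: n; exists N.*2.
have n1 : (1 <= n)%N by near: n; exists 1%N.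
have n0 : 0 < n%:R :> R by rewrite ltr0n.
set Y := n%:R `^ p; have Y0 : 0 < Y by rewrite powR_gt0.
set Z := 2 `^ p; have Z0 : 0 < Z by rewrite powR_gt0.
pose h := n./2.
have hn : (h <= n)%N by rewrite /h; lia.
have hN : (N <= h)%N by rewrite /h; lia.
have h2 : n%:R / 2 <= h.+1%:R :> R.
  rewrite ler_pdivrMr// -natrM ler_nat /h; lia.
have nh : n%:R / 2 <= (n - h)%:R :> R.
  rewrite ler_pdivrMr// -natrM ler_nat /h; lia.
have up : l n <= c2 * Z * Y.
  have Nn : (N <= n)%N by lia.
  have /andP[_ u] : _ && _ := HN n Nn.
  apply: (le_trans u); rewrite -mulrA ler_pM2l// /Z /Y -powRM ?ler0n//.
  apply: ge0_ler_powR; rewrite ?nnegrE ?mulr_ge0 ?ler0n ?(ltW p0)//.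
  rewrite -natrM ler_nat; lia.
have lo : n%:R / 2 * (c1 * (Y / Z)) <= \sum_(k < n) l k.
  rewrite -(big_mkord xpredT l) (big_cat_nat (n := h))//=.
  rewrite -[leLHS]add0r lerD ?sumr_ge0//.
  apply: (@le_trans _ _ (\sum_(h <= k < n) (c1 * (Y / Z)))).
    rewrite sumr_const_nat -[leRHS]mulr_natl ler_wpM2r//.
    by rewrite mulr_ge0 ?divr_ge0 ?(ltW c10) ?(ltW Y0) ?(ltW Z0).
  apply: ler_sum_nat => k /andP[hk _].
  have /andP[u _] : _ && _ := HN k (leq_trans hN hk).
  apply: le_trans u; rewrite ler_pM2l//.
  have -> : Y / Z = (n%:R / 2) `^ p.
    rewrite powRM ?invr_ge0// /Y /Z; congr (_ * _).
    by rewrite -powR_inv1// powRAC powR_inv1 ?powR_ge0.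
  apply: ge0_ler_powR; rewrite ?nnegrE ?divr_ge0 ?ler0n ?(ltW p0)//.
  by apply: (le_trans h2); rewrite ler_nat.
apply: (le_trans up); apply: le_trans (ler_wpM2l (ltW e0) lo).
have big : 2 * c2 * Z * Z / (eps * c1) <= n%:R by near: n; exact: nbhs_infty_ger.
rewrite ler_pdivrMr ?mulr_gt0// in big.
rewrite (_ : eps * _ = n%:R * (eps * c1) * Y / (2 * Z)); last by field; rewrite gt_eqF.
rewrite ler_pdivlMr ?mulr_gt0//.
rewrite (_ : c2 * Z * Y * (2 * Z) = 2 * c2 * Z * Z * Y); last by ring.
by rewrite ler_pM2r.
Unshelve. all: end_near. Qed.

End growth.

(** * Digits that follow a given growth *)

Section windows_of_growth.
Context {R : realType}.

Lemma ln2_le1 : ln 2 <= 1 :> R.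
Proof. by rewrite (_ : 2 = 1 + 1 :> R)// le_ln1Dx//; lra. Qed.

(** The n-th digit is allowed to range over the integers between [expR (g n)]
    and [expR (g n + n `^ (- K))]. There are about [expR (g n) * n `^ (- K)] of
    them, and the factor [n `^ (- K)] does not matter for the dimension because
    [ln n] is negligible before [g n]. The second asymptotic hypothesis makes
    consecutive windows disjoint, so the digits increase. *)
Lemma hausdorff_measure_growth (A : set R) (g : nat -> R) (c1 c2 p K : R) :
  0 < c1 -> 0 < c2 -> 0 < p -> 0 <= K ->
  (\forall n \near \oo, c1 * n%:R `^ p <= g n <= c2 * n%:R `^ p) ->
  (\forall n \near \oo, g n + n%:R `^ (- K) <= g n.+1) ->
  (forall d, digit_seq d ->
    (\forall n \near \oo,
       g n.+1 <= ln (d n)%:R <= g n.+1 + n.+1%:R `^ (- K)) ->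
    A (pierce_point d)) ->
  forall s, 0 <= s -> s < 1 -> hausdorff_measure s A <> 0%E.
Proof.
move=> c10 c20 p0 K0 gp gS Ad.
(* Digit sequences are numbered from 0, hence the shift. *)
pose f k := g k.+1; pose w k : R := k.+1%:R `^ (- K).
have w0 k : 0 < w k by rewrite powR_gt0.
have w1 k : w k <= 1.
  by rewrite -(powRr0 k.+1%:R) /w ler_powR ?ler1n// oppr_le0.
have lnw k : ln (w k) = - (K * ln k.+1%:R) by rewrite /w ln_powR mulNr.
have lnk k : 0 <= ln k.+1%:R :> R by rewrite ln_ge0 ?ler1n.
have fln (M : R) : \forall k \near \oo, M * (1 + ln k.+1%:R) <= f k.
  near=> k.
  have /andP[lo _] : c1 * k.+1%:R `^ p <= f k <= c2 * k.+1%:R `^ p.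
    by near: k; exact: (near_succ gp).
  have : M / c1 * (1 + ln k.+1%:R) <= k.+1%:R `^ p.
    by near: k; exact: (near_succ (near_ln_le_powR _ p0)).
  by rewrite mulrAC ler_pdivrMr// mulrC => /le_trans; apply; rewrite [leLHS]mulrC.
have [N _ HN] : \forall k \near \oo,
    [/\ f k + w k <= f k.+1, c1 * k.+1%:R `^ p <= f k <= c2 * k.+1%:R `^ p &
        (1 + K) * (1 + ln k.+1%:R) <= f k].
  near=> k; split; near: k; [exact: (near_succ gS)|exact: (near_succ gp)|exact: fln].
(* Before rank [N], where the asymptotic hypotheses are not available, the
   window is reduced to the single digit [k.+1]. *)
pose a k := if (k < N)%N then k.+1 else (Num.trunc (expR (f k))).+1.
pose m k := if (k < N)%N then 1%N else
  (Num.trunc (expR (f k + w k)) - Num.trunc (expR (f k)))%N.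
have tr (x : R) : (Num.trunc (expR x))%:R <= expR x < (Num.trunc (expR x)).+1%:R.
  by rewrite truncn_itv// expR_ge0.
have ffw k : (Num.trunc (expR (f k)) <= Num.trunc (expR (f k + w k)))%N.
  by apply: le_truncn; rewrite ler_expR lerDl ltW.
have fgt k : (N <= k)%N -> 1 + K * ln k.+1%:R + ln k.+1%:R <= f k.
  move=> /HN[_ _]; apply: le_trans.
  by have := lnk k; nra.
have mlow k : (N <= k)%N ->
    expR (f k) * w k / 2 <= (m k)%:R /\ 1 <= expR (f k) * w k / 2.
  move=> Nk; rewrite /m ltnNge Nk/= natrB//.
  have big : 2 <= expR (f k) * w k.
    rewrite -[w k]lnK ?posrE// -expRD lnw.
    apply: le_trans (expR_ge1Dx _).
    by have := fgt k Nk; have := lnk k; lra.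
  have : expR (f k) * (1 + w k) <= expR (f k + w k).
    by rewrite expRD ler_pM2l ?expR_gt0// expR_ge1Dx.
  have /andP[h1 _] := tr (f k); have /andP[_] := tr (f k + w k).
  rewrite -natr1 => h2 h3; split; lra.
have m0 k : (0 < m k)%N.
  have [kN|Nk] := ltnP k N; first by rewrite /m kN.
  by have [h1 h2] := mlow k Nk; rewrite -(@ltr_nat R); lra.
have amE k : (N <= k)%N -> (a k + m k = (Num.trunc (expR (f k + w k))).+1)%N.
  by move=> Nk; rewrite /a /m ltnNge Nk/=; have := ffw k; lia.
have a0 : (0 < a 0)%N by rewrite /a; case: ifP.
have aS k : (a k + m k <= a k.+1)%N.
  have [kN|Nk] := ltnP k N.
    rewrite {1}/a /m kN; have [kN'|Nk'] := ltnP k.+1 N.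
      by rewrite /a kN'; lia.
    rewrite /a ltnNge Nk'/= addn1 ltnS.
    rewrite truncn_ge_nat ?expR_ge0//.
    rewrite -[leLHS]lnK ?posrE// ler_expR.
    apply: le_trans (fgt k.+1 Nk').
    have : ln k.+1%:R <= ln k.+2%:R :> R by rewrite ler_ln ?posrE// ler_nat.
    by have := mulr_ge0 K0 (lnk k.+1); lra.
  rewrite amE// /a ifF ?ltnS; last by lia.
  by apply: le_truncn; rewrite ler_expR; have [] := HN k Nk.
pose b k : R := (a k + m k)%:R.
have b1 k : 1 <= b k by rewrite /b ler1n addn_gt0 m0 orbT.
have lnb k : (N <= k)%N -> f k <= ln (b k) <= f k + 2.
  move=> Nk; rewrite /b amE//; have /andP[l u] := tr (f k + w k).
  have fw0 : 0 <= f k + w k.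
    have := fgt k Nk; have := lnk k; have := mulr_ge0 K0 (lnk k); have := w0 k; lra.
  apply/andP; split.
    rewrite -[leLHS]expRK ler_ln ?posrE ?expR_gt0//.
    by apply: le_trans (ltW u); rewrite ler_expR lerDl ltW.
  apply: (@le_trans _ _ (ln (2 * expR (f k + w k)))).
    rewrite ler_ln ?posrE ?mulr_gt0 ?expR_gt0// -natr1.
    have : 1 <= expR (f k + w k) by rewrite -expR0 ler_expR.
    lra.
  rewrite lnM ?posrE ?expR_gt0// expRK.
  have := ln2_le1; have := w1 k; lra.
have H1 eps : 0 < eps ->
    \forall k \near \oo, (1 - eps) * ln (b k) <= ln (m k)%:R.
  move=> e0; near=> k.
  have Nk : (N <= k)%N by near: k; exists N.
  have [h1 h2] := mlow k Nk; have /andP[l u] := lnb k Nk.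
  have h3 : f k - K * ln k.+1%:R - 1 <= ln (m k)%:R.
    apply: (@le_trans _ _ (ln (expR (f k) * w k / 2))).
      rewrite lnM ?posrE ?mulr_gt0 ?expR_gt0//.
      rewrite lnM ?posrE ?mulr_gt0 ?expR_gt0// expRK lnw lnV ?posrE//.
      by have := ln2_le1; lra.
    by rewrite ler_ln ?posrE ?ltr0n ?m0// (lt_le_trans _ h2).
  apply: le_trans h3.
  have : (3 + K) / eps * (1 + ln k.+1%:R) <= f k by near: k; exact: fln.
  rewrite mulrAC ler_pdivrMr// => h4.
  have ef : eps * f k <= eps * ln (b k) by rewrite ler_pM2l.
  have := mulr_ge0 K0 (lnk k); have := lnk k; nra.
have H2 eps : 0 < eps ->
    \forall n \near \oo, ln (b n) <= eps * \sum_(k < n) ln (b k).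
  apply: (@poly_growth_sum _ (fun k => ln (b k)) c1 (c2 + 2) p) => //; first lra.
    by move=> k; exact: ln_ge0.
  near=> k.
  have Nk : (N <= k)%N by near: k; exists N.
  have /andP[l u] := lnb k Nk; have [_ /andP[l' u'] _] := HN k Nk.
  rewrite (le_trans l' l)/=.
  have : 1 <= k.+1%:R `^ p :> R.
    by rewrite -[leLHS](powRr0 k.+1%:R) ler_powR ?ler1n// ltW.
  by rewrite mulrDl; lra.
apply: (hausdorff_measure_window a0 m0 aS); last first.
  apply: (@window_exponent R b (fun k => (m k)%:R)) => //.
  by move=> k; rewrite ltr0n.
move=> d dd dw; apply: Ad => //; near=> k.
have Nk : (N <= k)%N by near: k; exists N.
have := dw k; rewrite amE// /a ltnNge Nk/= ltnS => /andP[lo up].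
have dk0 : 0 < (d k)%:R :> R by rewrite ltr0n (leq_trans _ lo).
rewrite -/(f k) -/(w k); apply/andP; split.
  rewrite -[leLHS]expRK ler_ln ?posrE ?expR_gt0//.
  by have /andP[_ /ltW u] := tr (f k); rewrite (le_trans u)// ler_nat.
rewrite -[leRHS]expRK ler_ln ?posrE ?expR_gt0//.
by have /andP[u _] := tr (f k + w k); rewrite (le_trans _ u)// ler_nat.
Unshelve. all: end_near. Qed.

End windows_of_growth.

(** * Power growths *)

Section power_growth.
Context {R : realType}.

Lemma ln_succ_ratio (n : nat) : (0 < n)%N ->
  (2 * n%:R)^-1 <= ln (n.+1%:R : R) - ln n%:R <= n%:R^-1.
Proof.
move=> n0; have x0 : 1 <= n%:R :> R by rewrite ler1n.
rewrite -(natr1 n); set x : R := n%:R in x0 *.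
rewrite -ln_div ?posrE; [|lra|lra]; apply/andP; split; last first.
  rewrite mulrDl divff ?mul1r; last by rewrite gt_eqF//; lra.
  have : 0 < x^-1 by rewrite invr_gt0; lra.
  by move=> ?; apply: le_ln1Dx; lra.
have -> : (x + 1) / x = (x / (x + 1))^-1 by rewrite invf_div.
rewrite lnV ?posrE; last by apply: divr_gt0; lra.
have -> : x / (x + 1) = 1 + (- (x + 1)^-1) by field; lra.
have y1 : (x + 1)^-1 < 1 by rewrite invf_lt1; lra.
have : ln (1 + (- (x + 1)^-1)) <= - (x + 1)^-1 by apply: le_ln1Dx; lra.
have : (2 * x)^-1 <= (x + 1)^-1 by rewrite lef_pV2 ?posrE; lra.
lra.
Qed.

Lemma expR_sub1_le (u : R) : `|expR u - 1| <= `|u| * expR `|u|.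
Proof.
have e1 := expR_ge1Dx u.
have e3 : (1 - u) * expR u <= 1.
  by have := expR_ge1Dx (- u); rewrite expRN -[leRHS]mul1r ler_pdivlMr ?expR_gt0.
have [u0|u0] := leP 0 u.
  rewrite [`|u|]ger0_norm// ger0_norm; lra.
rewrite [`|u|]ltr0_norm//.
have : 1 <= expR (- u) by rewrite -expR0 ler_expR; lra.
have : expR u <= 1 by rewrite -expR0 ler_expR ltW.
move=> e4 e5; rewrite ler0_norm; last lra.
nra.
Qed.

Lemma powR_succ (r : R) (n : nat) : (0 < n)%N ->
  n.+1%:R `^ r = n%:R `^ r * expR (r * (ln n.+1%:R - ln n%:R)).
Proof.
by move=> n0; rewrite /powR !gt_eqF ?ltr0n// -expRD; congr expR; ring.
Qed.

Lemma powRB_gt0 (x r t : R) : 0 < x -> x `^ (r - t) = x `^ r / x `^ t.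
Proof. by move=> x0; rewrite powRB// (gt_eqF x0) implybT. Qed.

Lemma powR_increment_ge (p : R) (n : nat) : 0 < p -> (0 < n)%N ->
  p / 2 * n%:R `^ (p - 1) <= n.+1%:R `^ p - n%:R `^ p.
Proof.
move=> p0 n0; rewrite powR_succ//.
have n1 : 0 < n%:R :> R by rewrite ltr0n.
have /andP[lo _] := ln_succ_ratio n0.
rewrite powRB_gt0// powRr1 ?ler0n//.
have Y0 : 0 < n%:R `^ p :> R by rewrite powR_gt0.
have : p * (2 * n%:R)^-1 <= expR (p * (ln n.+1%:R - ln n%:R)) - 1.
  have := expR_ge1Dx (p * (ln n.+1%:R - ln n%:R)).
  by have := ler_wpM2l (ltW p0) lo; lra.
move=> /(ler_wpM2l (ltW Y0)); rewrite mulrBr mulr1; apply: le_trans.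
rewrite le_eqVlt; apply/orP; left; apply/eqP; field; lra.
Qed.

Lemma powR_increment_le (q : R) (n : nat) : (0 < n)%N ->
  `|n.+1%:R `^ q - n%:R `^ q| <= `|q| * expR `|q| * n%:R `^ (q - 1).
Proof.
move=> n0; rewrite powR_succ//.
have n1 : 0 < n%:R :> R by rewrite ltr0n.
have /andP[lo up] := ln_succ_ratio n0.
have Y0 : 0 < n%:R `^ q :> R by rewrite powR_gt0.
set v := ln n.+1%:R - ln n%:R in lo up *.
have v0 : 0 <= v by apply: le_trans lo; rewrite invr_ge0 mulr_ge0 ?ler0n.
have v1 : v <= 1 by rewrite (le_trans up)// invf_le1 ?ler1n.
rewrite -[X in _ - X]mulr1 -mulrBr normrM (gtr0_norm Y0).
rewrite powRB_gt0// powRr1 ?ler0n// mulrCA ler_pM2l//.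
apply: (le_trans (expR_sub1_le _)); rewrite normrM (ger0_norm v0).
rewrite [leRHS]mulrAC; apply: ler_pM; rewrite ?mulr_ge0 ?expR_ge0//.
  by rewrite ler_wpM2l.
by rewrite ler_expR ler_piMr.
Qed.

(** This family contains a suitable growth for each admissible limit; the second
    term tunes the lower order behaviour. *)
Definition power_growth (c p b q : R) (n : nat) : R :=
  c * n%:R `^ p + b * n%:R `^ q.

Lemma power_growth_bounds c p b q : 0 < c -> q < p ->
  \forall n \near \oo,
    c / 2 * n%:R `^ p <= power_growth c p b q n <= 2 * c * n%:R `^ p.
Proof.
move=> c0 qp; near=> n.
have n0 : (0 < n)%N by near: n; exists 1%N.
have n1 : 0 < n%:R :> R by rewrite ltr0n.
have : `|b| * 2 / c <= n%:R `^ (p - q) by near: n; apply: near_powR_ge; lra.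
have Yq : 0 < n%:R `^ q :> R by rewrite powR_gt0.
rewrite powRB_gt0// ler_pdivrMr// mulrAC ler_pdivlMr// => h.
have := ler_norm (b * n%:R `^ q); have := ler_norm (- (b * n%:R `^ q)).
rewrite normrN normrM (gtr0_norm Yq) /power_growth => h1 h2.
apply/andP; split; lra.
Unshelve. all: end_near. Qed.

Lemma power_growth_increment c p b q K : 0 < c -> 0 < p -> q < p -> 1 <= K ->
  \forall n \near \oo,
    power_growth c p b q n + n%:R `^ (- K) <= power_growth c p b q n.+1.
Proof.
move=> c0 p0 qp K1; near=> n.
have n0 : (0 < n)%N by near: n; exists 1%N.
have n1 : 0 < n%:R :> R by rewrite ltr0n.
pose D := `|b| * (`|q| * expR `|q|).
have Z0 : 0 < n%:R `^ (p - 1) :> R by rewrite powR_gt0.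
(* The first term increases by at least c p / 2 times [n `^ (p - 1)]. One half
   of that absorbs the variation of the second term, the other half the
   window. *)
have h1 : D * n%:R `^ (q - 1) <= c * p / 4 * n%:R `^ (p - 1).
  have : D * 4 / (c * p) <= n%:R `^ ((p - 1) - (q - 1)).
    by near: n; apply: near_powR_ge; lra.
  rewrite powRB_gt0// ler_pdivlMr ?powR_gt0//.
  by rewrite mulrAC ler_pdivrMr ?mulr_gt0//; lra.
have h2 : n%:R `^ (- K) <= c * p / 4 * n%:R `^ (p - 1).
  have : 4 / (c * p) <= n%:R `^ ((p - 1) - (- K)).
    by near: n; apply: near_powR_ge; lra.
  rewrite powRB_gt0// ler_pdivlMr ?powR_gt0//.
  by rewrite mulrAC ler_pdivrMr ?mulr_gt0//; lra.
have h3 := ler_wpM2l (ltW c0) (powR_increment_ge p0 n0).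
have h4 := ler_wpM2l (normr_ge0 b) (powR_increment_le q n0).
rewrite -normrM in h4; have := ler_norm (- (b * (n.+1%:R `^ q - n%:R `^ q))).
rewrite normrN /power_growth => h5.
rewrite /D in h1; lra.
Unshelve. all: end_near. Qed.

Lemma cvg_powRN (r : R) : 0 < r -> n%:R `^ (- r) @[n --> \oo] --> (0 : R).
Proof.
move=> r0; apply/cvgrPdist_le => e e0; near=> n.
have n1 : 0 < n%:R :> R by rewrite ltr0n; near: n; exists 1%N.
rewrite sub0r normrN ger0_norm ?powR_ge0// powRN -[leRHS]invrK.
rewrite lef_pV2 ?posrE ?invr_gt0 ?powR_gt0//.
by near: n; exact: near_powR_ge.
Unshelve. all: end_near. Qed.

(** Only the behaviour of [power_growth] itself matters: the width
    [n `^ (- K)] of the windows is chosen small before [n `^ alpha], so the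
    freedom left to the digits is invisible in the limit. *)
Lemma dim_E_set_power_growth alpha beta c p b q :
  0 < c -> 0 < p -> q < p ->
  ((power_growth c p b q n - n%:R) / n%:R `^ alpha)%:E @[n --> \oo] --> beta ->
  hausdorff_dim (@E_set R alpha beta) = 1%E.
Proof.
move=> c0 p0 qp cvgG; apply: hausdorff_dim1; first by move=> x [].
pose K := 1 + `|alpha|.
have K1 : 1 <= K by rewrite /K lerDl.
apply: (@hausdorff_measure_growth _ _
  (power_growth c p b q) (c / 2) (2 * c) p K) => //; [lra|lra|lra| | |].
- exact: power_growth_bounds.
- exact: power_growth_increment.
move=> d dd Hd; split.
- have /andP[lb ub] := @pierce_point_itv R d dd.
  rewrite (lt_trans _ lb) ?invr_gt0//= (le_trans (ltW ub))// invf_le1 ?ler1n ?ltr0n.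
    by case: dd.
  by case: dd.
- exact: pierce_point_irrational.
(* The deviation of the digits from the growth, in the scale of the limit. *)
pose theta (n : nat) : R :=
  (ln (pierce_digit n (pierce_point d : R))%:~R - power_growth c p b q n) /
  n%:R `^ alpha.
have th0 : (theta n)%:E @[n --> \oo] --> 0%:E.
  apply: cvg_EFin; first by apply: nearW.
  apply: (@squeeze_cvgr _ _ _ _ (fun=> 0) (fun n : nat => n%:R `^ (- (K + alpha)))).
  - apply: near_inftyS; near=> n.
    have n1 : 0 < n.+1%:R :> R by rewrite ltr0n.
    rewrite /theta /= (pierce_digit_point _ dd) -pmulrn.
    have /andP[lo up] : power_growth c p b q n.+1 <= ln (d n)%:R <=
        power_growth c p b q n.+1 + n.+1%:R `^ (- K).
      by near: n.
    apply/andP; split; first by rewrite divr_ge0 ?powR_ge0// subr_ge0.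
    rewrite (opprD K) powRB_gt0// ler_pM2r ?invr_gt0 ?powR_gt0//.
    lra.
  - exact: cvg_cst.
  - apply: cvg_powRN; rewrite /K; have := ler_norm (- alpha); rewrite normrN; lra.
have := cvgeD (fin_num_adde_defl beta (erefl : 0%:E \is a fin_num)) cvgG th0.
rewrite adde0 => /(_ _) cvgS; apply: cvg_trans cvgS.
apply: near_eq_cvg; apply: nearW => n /=.
by rewrite -EFinD /theta -mulrDl; congr (_ / _)%:E; ring.
Unshelve. all: end_near. Qed.

End power_growth.

(** * The sets E(alpha, beta) *)

Section E_set.
Context {R : realType}.
Implicit Types (alpha r : R) (beta : \bar R).

Lemma cvg_powR_pinfty r : 0 < r -> (n%:R `^ r)%:E @[n --> \oo] --> +oo%E.
Proof.
by move=> r0; apply/cvgeryP/cvgryPge => M; exact: near_powR_ge.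
Qed.

Lemma dim_E_set_eventually alpha beta (c p b q : R) (h : nat -> R) :
  0 < c -> 0 < p -> q < p ->
  (forall n, (0 < n)%N ->
     (power_growth c p b q n - n%:R) / n%:R `^ alpha = h n) ->
  (h n)%:E @[n --> \oo] --> beta ->
  hausdorff_dim (@E_set R alpha beta) = 1%E.
Proof.
move=> c0 p0 qp hE hb; apply: (@dim_E_set_power_growth _ _ _ c p b q) => //.
apply: cvg_trans hb; apply: near_eq_cvg; near=> n.
by rewrite hE//; near: n; exists 1%N.
Unshelve. all: end_near. Qed.

(** As [n `^ alpha] is negligible before [n], a linear growth whose slope is not 1
    gives an infinite limit. *)
Lemma dim_E_set_alpha_lt1 alpha beta : alpha < 1 ->
  hausdorff_dim (@E_set R alpha beta) = 1%E.
Proof.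
move=> a1; case: beta => [r| |].
- apply: (@dim_E_set_eventually _ _ 1 1 r alpha (fun=> r)) => //; last exact: cvg_cst.
  move=> n n0; rewrite /power_growth powRr1 ?ler0n// mul1r [n%:R + _]addrC addrK.
  by rewrite mulfK// gt_eqF// powR_gt0// ltr0n.
- apply: (@dim_E_set_eventually _ _ 2 1 0 0 (fun n => n%:R `^ (1 - alpha))) => //.
    move=> n n0; rewrite powRB_gt0 ?ltr0n// /power_growth powRr1 ?ler0n//.
    by congr (_ / _); ring.
  by apply: cvg_powR_pinfty; lra.
- apply: (@dim_E_set_eventually _ _ 2^-1 1 0 0
    (fun n => - (2^-1 * n%:R `^ (1 - alpha)))) => //.
    move=> n n0; rewrite powRB_gt0 ?ltr0n// /power_growth powRr1 ?ler0n//.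
    by rewrite mulrA -mulNr; congr (_ / _); field.
  apply/cvgerNyP/cvgrNyPle => M.
  near=> n; have : - 2 * M <= n%:R `^ (1 - alpha) by near: n; apply: near_powR_ge; lra.
  lra.
Unshelve. all: end_near. Qed.

(** Since [1 <= alpha], subtracting [n] costs at most a bounded amount in the
    scale [n `^ alpha], so any growth of larger order will do. *)
Lemma dim_E_set_pinfty alpha : 1 <= alpha ->
  hausdorff_dim (@E_set R alpha +oo%E) = 1%E.
Proof.
move=> a1.
apply: (@dim_E_set_eventually _ _ 1 (alpha + 1) 0 0
  (fun n => n%:R - n%:R `^ (1 - alpha))) => //; try lra.
  move=> n n0; have Y0 : n%:R `^ alpha != 0 :> R by rewrite gt_eqF// powR_gt0// ltr0n.
  rewrite powRB_gt0 ?ltr0n// /power_growth powRr1 ?ler0n//.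
  rewrite powRD ?gt_eqF ?ltr0n ?implybT// ?powRr1 ?ler0n//.
    by field.
  by lra.
apply/cvgeryP/cvgryPge => M; near=> n.
have n1 : 1 <= n%:R :> R by near: n; exact: nbhs_infty_ger.
have : n%:R `^ (1 - alpha) <= 1.
  by rewrite -[leRHS](powRr0 n%:R) ler_powR//; lra.
have : M + 1 <= n%:R by near: n; exact: nbhs_infty_ger.
lra.
Unshelve. all: end_near. Qed.

(** The linear growth of slope [1 + r] degenerates for [r = -1]; the logarithms of
    the digits must then grow to infinity slower than [n]. *)
Lemma dim_E_set_alpha_eq1 r : -1 <= r ->
  hausdorff_dim (@E_set R 1 r%:E) = 1%E.
Proof.
rewrite le_eqVlt => /predU1P[<-|r1].
  apply: (@dim_E_set_eventually _ _ 1 2^-1 0 0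
    (fun n => n%:R `^ (- 2^-1) - 1)) => //; try lra.
    move=> n n0; have n1 : 0 < n%:R :> R by rewrite ltr0n.
    rewrite (_ : - 2^-1 = 2^-1 - 1); last by field.
    rewrite powRB_gt0// /power_growth powRr1 ?ler0n//.
    by field; rewrite gt_eqF.
  rewrite -[X in X%:E]sub0r; apply: cvg_EFin; first exact: nearW.
  by apply: cvgB; [apply: cvg_powRN; lra|exact: cvg_cst].
apply: (@dim_E_set_eventually _ _ (1 + r) 1 0 0 (fun=> r)) => //; last exact: cvg_cst.
  lra.
move=> n n0; have n1 : 0 < n%:R :> R by rewrite ltr0n.
rewrite /power_growth powRr1 ?ler0n//; field; by rewrite gt_eqF.
Qed.

(** For [r = 0] the coefficient of [n `^ alpha] vanishes, and [n] becomes the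
    leading term. *)
Lemma dim_E_set_alpha_gt1 alpha r : 1 < alpha -> 0 <= r ->
  hausdorff_dim (@E_set R alpha r%:E) = 1%E.
Proof.
move=> a1; rewrite le_eqVlt => /predU1P[<-|r0].
  apply: (@dim_E_set_eventually _ _ 1 1 0 0 (fun=> 0)) => //; last exact: cvg_cst.
  by move=> n n0; rewrite /power_growth powRr1 ?ler0n// mul0r addr0 mul1r subrr mul0r.
apply: (@dim_E_set_eventually _ _ r alpha 1 1 (fun=> r)) => //; try lra;
  last exact: cvg_cst.
move=> n n0; rewrite /power_growth powRr1 ?ler0n// mul1r addrK.
by rewrite mulfK// gt_eqF// powR_gt0// ltr0n.
Qed.

Lemma ln_int_ge0 (z : int) : 0 <= ln (z%:~R : R).
Proof.
have [z0|z0] := leP z 0; first by rewrite ln0// lerz0.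
by apply: ln_ge0; rewrite ler1z.
Qed.

(** Digits have a nonnegative logarithm, so the quotient that defines [E_set] is
    at least [- n / n `^ alpha]. *)
Lemma E_set_limit_ge alpha beta x (l : \bar R) : E_set alpha beta x ->
  (- n%:R `^ (1 - alpha))%:E @[n --> \oo] --> l -> (l <= beta)%E.
Proof.
move=> [_ _ xb] cl; rewrite -(cvg_lim _ cl)// -(cvg_lim _ xb)//.
apply: lee_lim; [by apply/cvg_ex; exists l|by apply/cvg_ex; exists beta|].
near=> n; have n0 : 0 < n%:R :> R by rewrite ltr0n; near: n; exists 1%N.
rewrite lee_fin powRB_gt0// powRr1 ?ler0n// -mulNr ler_pM2r ?invr_gt0 ?powR_gt0//.
by rewrite lerDr ln_int_ge0.
Unshelve. all: end_near. Qed.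

Lemma E_set_alpha_eq1_ge beta x : E_set 1 beta x -> ((-1)%:E <= beta)%E.
Proof.
move=> xE; apply: (E_set_limit_ge xE); under eq_fun do rewrite subrr powRr0.
exact: cvg_cst.
Qed.

Lemma E_set_alpha_gt1_ge alpha beta x : 1 < alpha -> E_set alpha beta x ->
  (0%:E <= beta)%E.
Proof.
move=> a1 xE; apply: (E_set_limit_ge xE).
apply: cvg_EFin; first exact: nearW.
rewrite -oppr0; apply: cvgN; rewrite -opprB; apply: cvg_powRN; lra.
Qed.

End E_set.

Unset Implicit Arguments.

Theorem theorem1p15 (R : realType) (alpha : R) (beta : \bar R) :
  ([\/ alpha < 1,
       alpha = 1 /\ ((-1)%:E <= beta)%E |
       1 < alpha /\ (0%:E <= beta)%E] ->
    hausdorff_dim (E_set alpha beta) = 1%E) /\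
  (~ [\/ alpha < 1,
         alpha = 1 /\ ((-1)%:E <= beta)%E |
         1 < alpha /\ (0%:E <= beta)%E] ->
    E_set alpha beta = set0 /\ hausdorff_dim (E_set alpha beta) = 0%E).
Proof.
split=> [|nocase].
  case=> [|[->]|[a1]]; first exact: dim_E_set_alpha_lt1.
    case: beta => [r| |]; rewrite ?lee_fin ?leeNy_eq//; first exact: dim_E_set_alpha_eq1.
    by move=> _; exact: dim_E_set_pinfty.
  case: beta => [r| |]; rewrite ?lee_fin ?leeNy_eq//; first exact: dim_E_set_alpha_gt1.
  by move=> _; apply: dim_E_set_pinfty; exact: ltW.
suff E0 : E_set alpha beta = set0 by rewrite E0 hausdorff_dim_set0.
rewrite -subset0 => x xE; apply: nocase.
have [a1|a1|a1] := ltgtP alpha 1.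
- by constructor 1.
- by constructor 3; split=> //; exact: E_set_alpha_gt1_ge xE.
- by constructor 2; split=> //; move: xE; rewrite a1; exact: E_set_alpha_eq1_ge.
Qed.
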